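(* Suppose $Q\succ0$, $R\succ0$, $\lambda_y>0$, and $\Gamma,\mathcal{U},\mathcal{Y}$ are convex sets. Consider the bi-level problem $$\text{(B)}\qquad \min_{g,\ \sigma_y\in\Gamma,\ u\in\mathcal{U},\ y\in\mathcal{Y}}\ \|y\|_Q^2+\|u\|_R^2+\lambda_y\|\sigma_y\|_2^2\quad\text{subject to}\quad H^*g=\mathrm{col}(u_{\mathrm{ini}},\,y_{\mathrm{ini}}+\sigma_y,\,u,\,y),$$ where $H^*$ solves $\min_{\tilde H}\|\tilde H-H_{\mathrm d}\|_F^2$ subject to $\mathrm{rank}(\tilde H)=mL+n$; the $\ell_1$-constrained problem $$\text{(R)}\qquad \min_{g,\ \sigma_y\in\Gamma,\ u\in\mathcal{U},\ y\in\mathcal{Y}}\ \|y\|_Q^2+\|u\|_R^2+\lambda_y\|\sigma_y\|_2^2\quad\text{subject to}\quad H_{\mathrm d}\,g=\mathrm{col}(u_{\mathrm{ini}},\,y_{\mathrm{ini}}+\sigma_y,\,u,\,y),\quad \|g\|_1\le\alpha_{\mathrm c};$$ and the single-level problem $$\text{(P}_{\lambda_g})\qquad \min_{g,\ \sigma_y\in\Gamma,\ u\in\mathcal{U},\ y\in\mathcal{Y}}\ \|y\|_Q^2+\|u\|_R^2+\lambda_y\|\sigma_y\|_2^2+\lambda_g\|g\|_1\quad\text{subject to}\quad H_{\mathrm d}\,g=\mathrm{col}(u_{\mathrm{ini}},\,y_{\mathrm{ini}}+\sigma_y,\,u,\,y).$$ Let $\alpha_{\mathrm c}$ be sufficiently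 large and suppose (R) satisfies Slater's condition. Let $\lambda_g^*\ge0$ be a penalty parameter such that every optimal solution of (R) is an optimal solution of $(\mathrm{P}_{\lambda_g^*})$ (such a parameter exists). Then, for any $0\le\lambda_g\le\lambda_g^*$, problem $(\mathrm{P}_{\lambda_g})$ is a convex relaxation of (B) with respect to the function $f(\sigma_y,u,y):=\|y\|_Q^2+\|u\|_R^2+\lambda_y\|\sigma_y\|_2^2$, in the following sense: 1) $(\mathrm{P}_{\lambda_g})$ is a convex optimization problem; 2) any feasible $(\sigma_y,u,y)$ for (B) is feasible for $(\mathrm{P}_{\lambda_g})$; 3) for any optimal solution $(g^*,\sigma_y^*,u^*,y^* )$ of $(\mathrm{P}_{\lambda_g})$, $f(\sigma_y^*,u^*,y^* )$ is smaller than or equal to the optimal value of (B).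
   Context: Setting. $m,p,n,T_{\mathrm{ini}},N,T$ are positive integers ($n$ is the state dimension of the underlying model), $L:=T_{\mathrm{ini}}+N<T$. $\mathrm{col}(\cdot)$ stacks vectors/matrices vertically. For a sequence $\omega=\mathrm{col}(\omega(1),\dots,\omega(T))$, $\mathcal{H}_L(\omega)$ is the block Hankel matrix with $L$ block rows and $T-L+1$ columns whose $j$-th column is $\mathrm{col}(\omega(j),\dots,\omega(j+L-1))$. Given data $u_{\mathrm d}\in\mathbb{R}^{mT}$, $y_{\mathrm d}\in\mathbb{R}^{pT}$, partition $\mathcal{H}_L(u_{\mathrm d})=\mathrm{col}(U_{\mathrm P},U_{\mathrm F})$ and $\mathcal{H}_L(y_{\mathrm d})=\mathrm{col}(Y_{\mathrm P},Y_{\mathrm F})$, where $U_{\mathrm P},Y_{\mathrm P}$ consist of the first $T_{\mathrm{ini}}$ block rows and $U_{\mathrm F},Y_{\mathrm F}$ of the last $N$ block rows. Put $H_{\mathrm d}:=\mathrm{col}(U_{\mathrm P},Y_{\mathrm P},U_{\mathrm F},Y_{\mathrm F})$. The optimal solution of the inner problem of (B) is taken to be the truncated SVD $H^*=H_{\mathrm{lr}}^*=\sum_{i=1}^{mL+n}\bar\sigma_i\bar u_i\bar v_i^{\mathsf T}$, where $H_{\mathrm d}=\sum_{i=1}^{(m+p)L}\bar\sigma_i\bar u_i\bar v_i^{\mathsf T}$ is the singular value decomposition with singular values in nonincreasing order (the paper treats this solution as unique). Vectors $u_{\mathrm{ini}}\in\mathbb{R}^{mT_{\mathrm{ini}}}$,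 $y_{\mathrm{ini}}\in\mathbb{R}^{pT_{\mathrm{ini}}}$ are given. Decision variables: $g\in\mathbb{R}^{T-L+1}$, $\sigma_y\in\mathbb{R}^{pT_{\mathrm{ini}}}$, $u\in\mathbb{R}^{mN}$, $y\in\mathbb{R}^{pN}$. $\|y\|_Q^2$ denotes $\sum_k y(k)^{\mathsf T}Qy(k)$ over the $N$ blocks $y(k)\in\mathbb{R}^p$ of $y$, similarly $\|u\|_R^2$. $\Gamma\subseteq\mathbb{R}^{pT_{\mathrm{ini}}}$, $\mathcal{U}\subseteq\mathbb{R}^m$, $\mathcal{Y}\subseteq\mathbb{R}^p$; by abuse of notation $u\in\mathcal{U}$ ($y\in\mathcal{Y}$) means that every block $u(k)\in\mathcal{U}$ ($y(k)\in\mathcal{Y}$). A triple $(\sigma_y,u,y)$ is called feasible for a problem if there is a $g$ such that $(g,\sigma_y,u,y)$ is feasible. ''$\alpha_{\mathrm c}$ sufficiently large'' means: there is a threshold $\bar\alpha$ (depending on the problem data) such that the statement holds for all $\alpha_{\mathrm c}\ge\bar\alpha$. Slater's condition for (R): there is a feasible point with $(\sigma_y,u,y)$ in the relative interior of the constraint set and $\|g\|_1<\alpha_{\mathrm c}$.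
   Formalization: Item 3) is stated under the added assumption that (R) has an optimal solution; for non-closed convex sets (R) may not attain its minimum, the condition on the penalty parameter is then vacuous, and 3) can fail. *)

(* Defs.v *)
From mathcomp Require Export all_boot all_order all_algebra.
From mathcomp Require Export all_classical all_reals all_analysis.
Export numFieldNormedType.Exports.

Set Implicit Arguments.
Unset Strict Implicit.
Unset Printing Implicit Defensive.

Import Order.TTheory GRing.Theory Num.Theory.

Local Open Scope classical_set_scope.
Local Open Scope ring_scope.

(* A sequence of k vectors of R^b is stored as a stacked column of size k * b:
   component i of block t (both counted from 0) sits at position t * b + i.
   The default value 0 of [entry] is only reached outside that range. *)
Definition entry (R : realType) (k : nat) (w : 'cV[R]_k) (i : nat) : R :=
  oapp (fun j => w j 0) 0 (insub i).

Definition block (R : realType) (k b : nat) (w : 'cV[R]_(k * b)) (t : nat) :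
    'cV[R]_b :=
  \col_i entry w (t * b + i).

(* Column j is the contiguous slice of L blocks starting at block j. *)
Definition hankel (R : realType) (T b L : nat) (w : 'cV[R]_(T * b)) :
    'M[R]_(L * b, (T - L).+1) :=
  \matrix_(i, j) entry w (j * b + i).

Definition hankel_past (R : realType) (T b Tini N : nat) (w : 'cV[R]_(T * b)) :
    'M[R]_(Tini * b, (T - (Tini + N)).+1) :=
  usubmx (castmx (mulnDl Tini N b, erefl) (hankel (Tini + N) w)).

Definition hankel_future (R : realType) (T b Tini N : nat)
    (w : 'cV[R]_(T * b)) : 'M[R]_(N * b, (T - (Tini + N)).+1) :=
  dsubmx (castmx (mulnDl Tini N b, erefl) (hankel (Tini + N) w)).

Definition data_matrix (R : realType) (m p Tini N T : nat)
    (ud : 'cV[R]_(T * m)) (yd : 'cV[R]_(T * p)) :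
    'M[R]_(Tini * m + (Tini * p + (N * m + N * p)), (T - (Tini + N)).+1) :=
  col_mx (hankel_past Tini N ud)
    (col_mx (hankel_past Tini N yd)
      (col_mx (hankel_future Tini N ud) (hankel_future Tini N yd))).

Definition frobenius_sq (R : realType) (q c : nat) (A : 'M[R]_(q, c)) : R :=
  \sum_i \sum_j A i j ^+ 2.

Definition low_rank_solution (R : realType) (q c : nat) (A : 'M[R]_(q, c))
    (r : nat) (B : 'M[R]_(q, c)) : Prop :=
  \rank B = r /\
  forall B' : 'M[R]_(q, c), \rank B' = r ->
    frobenius_sq (B - A) <= frobenius_sq (B' - A).

(* The sum has one term per row of A. When A has fewer columns than rows, at
   most c right singular vectors can be orthonormal; the terms of index >= c
   then carry a zero singular value and their v i is irrelevant. *)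
Definition is_svd (R : realType) (q c : nat) (A : 'M[R]_(q, c))
    (s : 'I_q -> R) (u : 'I_q -> 'cV[R]_q) (v : 'I_q -> 'cV[R]_c) : Prop :=
  [/\ (forall i j : 'I_q, (u i)^T *m u j = (i == j)%:R%:M),
      (forall i j : 'I_q, (i < c)%N -> (j < c)%N ->
         (v i)^T *m v j = (i == j)%:R%:M),
      (forall i : 'I_q, 0 <= s i /\ ((c <= i)%N -> s i = 0)),
      (forall i j : 'I_q, (i <= j)%N -> s j <= s i)
    & A = \sum_i s i *: (u i *m (v i)^T)].

Definition is_truncated_svd (R : realType) (q c : nat) (A : 'M[R]_(q, c))
    (r : nat) (B : 'M[R]_(q, c)) : Prop :=
  exists (s : 'I_q -> R) (u : 'I_q -> 'cV[R]_q) (v : 'I_q -> 'cV[R]_c),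
    is_svd A s u v /\ B = \sum_(i < q | (i < r)%N) s i *: (u i *m (v i)^T).

Definition posdef (R : realType) (k : nat) (Q : 'M[R]_k) : Prop :=
  Q^T = Q /\ forall x : 'cV[R]_k, x != 0 -> 0 < (x^T *m Q *m x) 0 0.

Definition weighted_sq (R : realType) (k b : nat) (Q : 'M[R]_b)
    (w : 'cV[R]_(k * b)) : R :=
  \sum_(t < k) ((block w t)^T *m Q *m block w t) 0 0.

Definition norm2_sq (R : realType) (k : nat) (x : 'cV[R]_k) : R :=
  \sum_i x i 0 ^+ 2.

Definition norm1 (R : realType) (k : nat) (x : 'cV[R]_k) : R :=
  \sum_i `|x i 0|.

Definition affine_hull (R : realType) (V : lmodType R) (A : set V) : set V :=
  [set x | exists (k : nat) (t : 'I_k -> R) (a : 'I_k -> V),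
     [/\ \sum_i t i = 1, (forall i, A (a i)) & x = \sum_i t i *: a i]].

Definition relative_interior (R : realType) (V : normedModType R) (A : set V) :
    set V :=
  [set x | A x /\ \forall y \near x, affine_hull A y -> A y].

Record problem (R : realType) (V : lmodType R) :=
  Problem { feasible : set V; cost : V -> R }.

Definition optimal (R : realType) (V : lmodType R) (P : problem V) : set V :=
  [set z | feasible P z /\ forall z', feasible P z' -> cost P z <= cost P z'].

(* +oo when the problem is infeasible. *)
Definition optimal_value (R : realType) (V : lmodType R) (P : problem V) :
    \bar R :=
  ereal_inf [set (cost P z)%:E | z in feasible P].

Definition convex_problem (R : realType) (V : lmodType R) (P : problem V) :
    Prop :=
  convex_set (feasible P) /\ convex_function setT (cost P).

(* The components are sigma_y, u and y. *)
Definition signals (R : realType) (m p Tini N : nat) : normedModType R :=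
  ('cV[R]_(Tini * p) * 'cV[R]_(N * m) * 'cV[R]_(N * p))%type.

Definition decision (R : realType) (c m p Tini N : nat) : normedModType R :=
  ('cV[R]_c * signals R m p Tini N)%type.

Definition feasible_for (R : realType) (c m p Tini N : nat)
    (P : problem (decision R c m p Tini N)) : set (signals R m p Tini N) :=
  [set x | exists g : 'cV[R]_c, feasible P (g, x)].

Definition constraint_set (R : realType) (m p Tini N : nat)
    (Gam : set 'cV[R]_(Tini * p)) (U : set 'cV[R]_m) (Y : set 'cV[R]_p) :
    set (signals R m p Tini N) :=
  [set x | let: (sigma, u, y) := x in
    [/\ Gam sigma, (forall k : 'I_N, U (block u k))
      & (forall k : 'I_N, Y (block y k))]].

Definition tracking_cost (R : realType) (m p Tini N : nat)
    (Q : 'M[R]_p) (Rw : 'M[R]_m) (lamy : R) (x : signals R m p Tini N) : R :=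
  let: (sigma, u, y) := x in
  weighted_sq Q y + weighted_sq Rw u + lamy * norm2_sq sigma.

Definition data_equation (R : realType) (c m p Tini N : nat)
    (H : 'M[R]_(Tini * m + (Tini * p + (N * m + N * p)), c))
    (uini : 'cV[R]_(Tini * m)) (yini : 'cV[R]_(Tini * p)) :
    set (decision R c m p Tini N) :=
  [set z | let: (g, (sigma, u, y)) := z in
    H *m g = col_mx uini (col_mx (yini + sigma) (col_mx u y))].

(* Main.v *)
From mathcomp Require Import ring lra.
Require Import Defs.

Set Implicit Arguments.
Unset Strict Implicit.
Unset Printing Implicit Defensive.

Import Order.TTheory GRing.Theory Num.Theory.

Local Open Scope classical_set_scope.
Local Open Scope ring_scope.

(** The truncated singular value decomposition factors through the data
    matrix: [Hstar = Hd *m M], where [M] projects onto the retained right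
    singular vectors ([truncated_svd_factor]). Hence every [g] feasible for the
    bi-level problem turns into [M *m g], feasible for the penalised problem
    with the same signals, and only the comparison of values needs work. It
    passes through an optimal solution [w] of the l1-constrained problem.

    The tracking cost of [w] bounds the bi-level problem from below once
    [alpha_c] is large ([l1_constrained_le_bilevel]). This cost is a positive
    definite quadratic form, so the signals at least as good as one fixed
    bi-level feasible point form a bounded set; a fixed generalised inverse of
    [Hd] then yields coefficients [g] with an l1 norm bounded uniformly over
    that set, and beyond this bound the l1 constraint excludes none of these
    signals. All other bi-level points are worse than the fixed one.

    The tracking cost of [w] is in turn at least that of any optimal solution
    [z] of the problem penalised with [lam <= lam_star]
    ([cost_le_smaller_penalty]). For [lam < lam_star] this is the usual
    exchange argument between two parametric problems. For [lam = lam_star] the penalised problem could have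
    several solutions that trade cost against norm; strict convexity of the
    tracking cost rules this out.

    That some [lam_star] exists is strong duality for a single convex
    inequality ([lagrange_multiplier]), which for one scalar constraint reduces
    to comparing the slopes of the optimal value on both sides of [alpha_c]. *)

(** * Convexity and the Lagrange multiplier of a convex constraint *)

Lemma convex_setP (R : realType) (V : lmodType R) (A : set V) :
  convex_set (M := V) A <->
  forall t x y, 0 <= t <= 1 -> A x -> A y -> A (t *: x + (1 - t) *: y).
Proof.
split=> [cA t x y /andP[t0 t1] Ax Ay|cA x y t].
  by have := cA x y (Itv01 t0 t1); rewrite !inE => /(_ Ax Ay).
by rewrite !inE => Ax Ay; apply: cA => //; apply/andP; split.
Qed.

Lemma convex_functionP (R : realType) (V : lmodType R) (f : V -> R) :
  convex_function (E := V) setT f <->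
  forall t x y, 0 <= t <= 1 ->
    f (t *: x + (1 - t) *: y) <= t * f x + (1 - t) * f y.
Proof.
split=> [cf t x y /andP[t0 t1]|cf t x y _ _].
  by have := cf (Itv01 t0 t1) x y; rewrite !inE => /(_ I I).
by apply: cf; apply/andP; split.
Qed.

Lemma convex_functionD (R : realType) (V : lmodType R) (f h : V -> R)
    (lam : R) :
  0 <= lam -> convex_function (E := V) setT f ->
  convex_function (E := V) setT h ->
  convex_function (E := V) setT (fun z => f z + lam * h z).
Proof.
move=> lam0 /convex_functionP cf /convex_functionP ch.
apply/convex_functionP => t x y t01.
have := lerD (cf t x y t01) (ler_wpM2l lam0 (ch t x y t01)).
by move=> /le_trans; apply; rewrite le_eqVlt; apply/orP; left; apply/eqP; ring.
Qed.

(** Slopes on the two sides of [alpha]: a segment from a point [a] violating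
    the constraint to a strictly feasible point [b] meets the level
    [h = alpha] at a point which cannot beat [w]. *)
Lemma slope_le (R : realType) (V : lmodType R) (F : set V) (f h : V -> R)
    (alpha : R) (w a b : V) :
  convex_set (M := V) F -> convex_function (E := V) setT f ->
  convex_function (E := V) setT h ->
  optimal (Problem [set z | F z /\ h z <= alpha] f) w ->
  F a -> F b -> alpha < h a -> h b < alpha ->
  (f w - f a) / (h a - alpha) <= (f b - f w) / (alpha - h b).
Proof.
move=> /convex_setP cF /convex_functionP cf /convex_functionP ch [_ wopt].
move=> Fa Fb ha hb.
have D0 : 0 < h a - h b by lra.
pose t := (alpha - h b) / (h a - h b).
have tD : t * (h a - h b) = alpha - h b by rewrite /t; field; lra.
have t01 : 0 <= t <= 1.
  by rewrite divr_ge0 ?ler_pdivrMr //=; lra.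
have hz : h (t *: a + (1 - t) *: b) <= alpha.
  by apply: le_trans (ch t a b t01) _; lra.
have := le_trans (wopt _ (conj (cF t a b t01 Fa Fb) hz)) (cf t a b t01).
move=> /= /(ler_wpM2r (ltW D0)).
have -> : (t * f a + (1 - t) * f b) * (h a - h b) =
          (alpha - h b) * f a + (h a - alpha) * f b.
  rewrite -tD (_ : h a - alpha = (1 - t) * (h a - h b)); first ring.
  by rewrite mulrBl tD; ring.
move=> fw.
by rewrite ler_pdivrMr ?subr_gt0 // mulrAC ler_pdivlMr ?subr_gt0 //; lra.
Qed.

(** Strong duality for one scalar constraint: the multiplier is the steepest
    slope at which the cost can decrease by violating the constraint, and the
    strictly feasible point bounds these slopes by [slope_le]. *)
Lemma lagrange_multiplier (R : realType) (V : lmodType R) (F : set V)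
    (f h : V -> R) (alpha : R) (w : V) :
  convex_set (M := V) F -> convex_function (E := V) setT f ->
  convex_function (E := V) setT h ->
  (exists2 b, F b & h b < alpha) ->
  optimal (Problem [set z | F z /\ h z <= alpha] f) w ->
  exists2 lam, 0 <= lam &
    forall a, F a -> f w + lam * alpha <= f a + lam * h a.
Proof.
move=> cF cf ch [b0 Fb0 hb0] wopt.
have [_ /= wle] := wopt.
(* The value 0 keeps the multiplier nonnegative when no violation pays off. *)
pose S : set R := [set q | q = 0 \/ exists a,
  [/\ F a, alpha < h a & q = (f w - f a) / (h a - alpha)]].
have Sub b : F b -> h b < alpha -> ubound S ((f b - f w) / (alpha - h b)).
  move=> Fb hb q [->|[a [Fa ha ->]]]; last exact: (slope_le cF cf ch).
  by rewrite divr_ge0 ?subr_ge0 ?(ltW hb) // wle //; split=> //; exact: ltW.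
have SM : has_ubound S by exists ((f b0 - f w) / (alpha - h b0)); exact: Sub.
have S0 : S 0 by left.
exists (sup S); first exact: ub_le_sup S0.
move=> a Fa; case: (ltgtP (h a) alpha) => [ha|ha|ha].
- have := ge_sup (ex_intro _ 0 S0) (Sub a Fa ha).
  by rewrite ler_pdivlMr ?subr_gt0 //; lra.
- have : (f w - f a) / (h a - alpha) <= sup S.
    by apply: ub_le_sup => //; right; exists a.
  by rewrite ler_pdivrMr ?subr_gt0 //; lra.
- by rewrite ha lerD2r; apply: wle; split=> //; rewrite ha.
Qed.

Lemma optimal_penalized (R : realType) (V : lmodType R) (F : set V)
    (f h : V -> R) (alpha : R) :
  convex_set (M := V) F -> convex_function (E := V) setT f ->
  convex_function (E := V) setT h ->
  (exists2 b, F b & h b < alpha) ->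
  exists2 lam, 0 <= lam &
    optimal (Problem [set z | F z /\ h z <= alpha] f) `<=`
    optimal (Problem F (fun z => f z + lam * h z)).
Proof.
move=> cF cf ch slater.
pose C := Problem [set z | F z /\ h z <= alpha] f.
have [[w wopt]|noopt] := pselect (optimal C !=set0); last first.
  by exists 0 => // w wopt; case: noopt; exists w.
have [lam lam0 lamP] := lagrange_multiplier cF cf ch slater wopt.
exists lam => // w' [[Fw' hw'] w'le]; split=> //= a Fa.
have fw'w : f w' <= f w by apply: w'le; case: wopt.
apply: le_trans (lamP a Fa).
by rewrite lerD // ler_wpM2l.
Qed.

(** Adding the two optimality inequalities gives
    [(lam_star - lam) * (h w - h z) <= 0]. If [lam < lam_star], then
    [h w <= h z] and the optimality of [z] gives the claim. If the parameters
    agree, [w] and [z] minimise the same function; were [f z] and [f w]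
    different, the midpoint of [w] and [z] would be better than both. *)
Lemma cost_le_smaller_penalty (R : realType) (V : lmodType R) (F : set V)
    (f h : V -> R) (lam lam_star : R) (w z : V) :
  convex_set (M := V) F -> convex_function (E := V) setT h ->
  (forall x y, f x != f y ->
     f (2^-1 *: x + (1 - 2^-1) *: y) < 2^-1 * f x + (1 - 2^-1) * f y) ->
  0 <= lam <= lam_star ->
  optimal (Problem F (fun z => f z + lam_star * h z)) w ->
  optimal (Problem F (fun z => f z + lam * h z)) z ->
  f z <= f w.
Proof.
move=> /convex_setP cF /convex_functionP ch sf /andP[lam0].
have half01 : 0 <= (2^-1 : R) <= 1 by lra.
rewrite le_eqVlt => /predU1P[<-|lt_lam] [/= Fw wle] [/= Fz zle].
  rewrite leNgt; apply/negP => fwz.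
  have := zle _ (cF _ z w half01 Fz Fw).
  have := sf z w (negbT (gt_eqF fwz)).
  have := ler_wpM2l lam0 (ch _ z w half01).
  have := wle _ Fz; have := zle _ Fw; lra.
have := wle _ Fz; have zw := zle _ Fw => wz.
have hwz : h w <= h z.
  have gap : 0 < lam_star - lam by rewrite subr_gt0.
  by rewrite -subr_ge0 -(pmulr_rge0 _ gap); lra.
by have := ler_wpM2l lam0 hwz; lra.
Qed.

(** * Quadratic costs *)

Lemma quad_lincomb (R : realType) (k : nat) (Q : 'M[R]_k) (a b : R)
    (x y : 'cV[R]_k) :
  ((a *: x + b *: y)^T *m Q *m (a *: x + b *: y)) 0 0 =
  a ^+ 2 * (x^T *m Q *m x) 0 0 + b ^+ 2 * (y^T *m Q *m y) 0 0
  + a * b * ((x^T *m Q *m y) 0 0 + (y^T *m Q *m x) 0 0).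
Proof.
have -> : (a *: x + b *: y)^T = a *: x^T + b *: y^T.
  by apply/matrixP => i j; rewrite !mxE.
rewrite !(mulmxDl, mulmxDr) -?scalemxAl -?scalemxAr -?scalemxAl.
by rewrite !mxE; ring.
Qed.

(** Keeping the defect of convexity exact yields convexity and strict convexity
    together: the defect is again a value of the form. *)
Lemma quad_conv (R : realType) (k : nat) (Q : 'M[R]_k) (t : R)
    (x y : 'cV[R]_k) :
  ((t *: x + (1 - t) *: y)^T *m Q *m (t *: x + (1 - t) *: y)) 0 0 =
  t * (x^T *m Q *m x) 0 0 + (1 - t) * (y^T *m Q *m y) 0 0
  - t * (1 - t) * ((x - y)^T *m Q *m (x - y)) 0 0.
Proof.
have -> : x - y = 1 *: x + (-1) *: y by rewrite scale1r scaleN1r.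
by rewrite !quad_lincomb; ring.
Qed.

Lemma posdef_ge0 (R : realType) (k : nat) (Q : 'M[R]_k) (x : 'cV[R]_k) :
  posdef Q -> 0 <= (x^T *m Q *m x) 0 0.
Proof.
move=> [_ Q0]; have [->|/Q0/ltW//] := eqVneq x 0.
by rewrite mulmx0 mxE.
Qed.

Lemma posdef_unitmx (R : realType) (k : nat) (Q : 'M[R]_k) :
  posdef Q -> Q \in unitmx.
Proof.
move=> [_ Q0]; rewrite unitmxE unitfE; apply/negP => /det0P[v v0 vQ].
have := Q0 v^T; rewrite trmx_eq0 => /(_ v0).
by rewrite trmxK vQ mul0mx mxE ltxx.
Qed.

(** Cauchy-Schwarz in the inner product of [Q]: the coordinate [x i] is the
    inner product of [x] with [invmx Q *m delta_mx i 0]. *)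
Lemma posdef_coord_le (R : realType) (k : nat) (Q : 'M[R]_k) :
  posdef Q -> exists2 C, 0 <= C &
    forall (x : 'cV[R]_k) i, x i 0 ^+ 2 <= C * (x^T *m Q *m x) 0 0.
Proof.
move=> Qpos; have Qu := posdef_unitmx Qpos; have [Qsym Q0] := Qpos.
pose q i : 'cV[R]_k := invmx Q *m delta_mx i 0.
pose n i := ((q i)^T *m Q *m q i) 0 0.
have n0 i : 0 <= n i by exact: posdef_ge0.
exists (\sum_i n i) => [|x i]; first exact: sumr_ge0.
apply: (@le_trans _ _ (n i * (x^T *m Q *m x) 0 0)); last first.
  rewrite ler_wpM2r ?posdef_ge0 // (bigD1 i) //= lerDl.
  by apply: sumr_ge0.
have Qq : Q *m q i = delta_mx i 0 by rewrite mulKVmx.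
have qn0 : q i != 0.
  apply/eqP => q0; have := Qq; rewrite q0 mulmx0 => /matrixP/(_ i 0)/eqP.
  by rewrite !mxE !eqxx eq_sym oner_eq0.
have xq : (x^T *m Q *m q i) 0 0 = x i 0.
  rewrite -mulmxA Qq -[x^T]mulmx1 -mulmxA mul1mx -colE !mxE //.
have qx : ((q i)^T *m Q *m x) 0 0 = x i 0.
  rewrite -xq; transitivity ((x^T *m Q *m q i)^T 0 0); last by rewrite mxE.
  by rewrite !trmx_mul trmxK Qsym mulmxA.
have npos : 0 < n i by exact: Q0.
have := posdef_ge0 (n i *: x + (- x i 0) *: q i) Qpos.
rewrite quad_lincomb xq qx -/(n i) => defect_ge0.
by rewrite -(ler_pM2l npos); lra.
Qed.

Lemma block_lincomb (R : realType) (k b : nat) (s t : R)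
    (x y : 'cV[R]_(k * b)) (l : nat) :
  block (s *: x + t *: y) l = s *: block x l + t *: block y l.
Proof.
apply/matrixP => i j; rewrite !mxE /entry; case: insub => /= [r|].
  by rewrite !mxE.
by rewrite !mulr0 addr0.
Qed.

Lemma block_sub (R : realType) (k b : nat) (x y : 'cV[R]_(k * b)) (l : nat) :
  block (x - y) l = block x l - block y l.
Proof. by have := block_lincomb 1 (-1) x y l; rewrite !scale1r !scaleN1r. Qed.

Lemma weighted_sq_conv (R : realType) (k b : nat) (Q : 'M[R]_b) (t : R)
    (x y : 'cV[R]_(k * b)) :
  weighted_sq Q (t *: x + (1 - t) *: y) =
  t * weighted_sq Q x + (1 - t) * weighted_sq Q y
  - t * (1 - t) * weighted_sq Q (x - y).
Proof.
rewrite /weighted_sq !mulr_sumr -big_split -sumrB; apply: eq_bigr => l _ /=.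
by rewrite block_lincomb block_sub quad_conv.
Qed.

Lemma norm2_sq_conv (R : realType) (k : nat) (t : R) (x y : 'cV[R]_k) :
  norm2_sq (t *: x + (1 - t) *: y) =
  t * norm2_sq x + (1 - t) * norm2_sq y - t * (1 - t) * norm2_sq (x - y).
Proof.
rewrite /norm2_sq !mulr_sumr -big_split -sumrB; apply: eq_bigr => l _ /=.
by rewrite !mxE; ring.
Qed.

Lemma weighted_sq_ge0 (R : realType) (k b : nat) (Q : 'M[R]_b)
    (x : 'cV[R]_(k * b)) : posdef Q -> 0 <= weighted_sq Q x.
Proof. by move=> Q0; apply: sumr_ge0 => l _; exact: posdef_ge0. Qed.

Lemma weighted_sq_coord_le (R : realType) (k b : nat) (Q : 'M[R]_b) :
  posdef Q -> exists2 C, 0 <= C &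
    forall (x : 'cV[R]_(k * b)) j, x j 0 ^+ 2 <= C * weighted_sq Q x.
Proof.
move=> Qpos; have [C C0 CP] := posdef_coord_le Qpos; exists C => // x j.
have b0 : (0 < b)%N by case: b {Q Qpos CP} x j => // x [j]; rewrite muln0.
have jk : (j %/ b < k)%N by rewrite ltn_divLR.
have jb : (j %% b < b)%N by rewrite ltn_mod.
have -> : x j 0 = block x (Ordinal jk) (Ordinal jb) 0.
  by rewrite mxE /entry /= -divn_eq insubT // => ltj; congr (x _ _);
    apply: val_inj.
apply: le_trans (CP _ _) _; rewrite ler_wpM2l //.
rewrite /weighted_sq (bigD1 (Ordinal jk)) //= lerDl.
by apply: sumr_ge0 => l _; exact: posdef_ge0.
Qed.

Lemma norm2_sq_coord_le (R : realType) (k : nat) (x : 'cV[R]_k) j :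
  x j 0 ^+ 2 <= norm2_sq x.
Proof.
rewrite /norm2_sq (bigD1 j) //= lerDl.
by apply: sumr_ge0 => l _; exact: sqr_ge0.
Qed.

Lemma tracking_cost_conv (R : realType) (m p Tini N : nat) (Q : 'M[R]_p)
    (Rw : 'M[R]_m) (lamy t : R) (x y : signals R m p Tini N) :
  let f := tracking_cost (Tini := Tini) (N := N) Q Rw lamy in
  f (t *: x + (1 - t) *: y) = t * f x + (1 - t) * f y - t * (1 - t) * f (x - y).
Proof.
case: x y => [[s1 u1] y1] [[s2 u2] y2] /=.
by rewrite !weighted_sq_conv norm2_sq_conv; ring.
Qed.

(** One estimate behind two facts: sublevel sets of the cost are bounded, and
    only the zero signals have cost zero. *)
Lemma tracking_cost_coord_le (R : realType) (m p Tini N : nat) (Q : 'M[R]_p)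
    (Rw : 'M[R]_m) (lamy : R) :
  posdef Q -> posdef Rw -> 0 < lamy ->
  exists2 C, 0 <= C &
    forall (sigma : 'cV[R]_(Tini * p)) (u : 'cV[R]_(N * m))
           (y : 'cV[R]_(N * p)),
      let c := C * tracking_cost Q Rw lamy (sigma, u, y) in
      [/\ forall i, sigma i 0 ^+ 2 <= c, forall i, u i 0 ^+ 2 <= c
        & forall i, y i 0 ^+ 2 <= c].
Proof.
move=> Q0 R0 lamy0.
have [CQ CQ0 CQP] := weighted_sq_coord_le N Q0.
have [CR CR0 CRP] := weighted_sq_coord_le N R0.
have Cl0 : 0 <= lamy^-1 by rewrite invr_ge0 ltW.
exists (CQ + CR + lamy^-1) => [|sigma u y]; first by rewrite !addr_ge0.
have fy := weighted_sq_ge0 y Q0.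
have fu := weighted_sq_ge0 u R0.
have fs : 0 <= lamy * norm2_sq sigma.
  by rewrite mulr_ge0 ?(ltW lamy0) // sumr_ge0 // => i _; exact: sqr_ge0.
have bound C r : 0 <= C -> 0 <= r -> C <= CQ + CR + lamy^-1 ->
    r <= tracking_cost Q Rw lamy (sigma, u, y) ->
    C * r <= (CQ + CR + lamy^-1) * tracking_cost Q Rw lamy (sigma, u, y).
  by move=> *; exact: ler_pM.
split=> i.
- apply: le_trans (norm2_sq_coord_le sigma i) _.
  rewrite -[norm2_sq sigma](mulKf (lt0r_neq0 lamy0)).
  by apply: bound => //=; lra.
- by apply: le_trans (CRP u i) _; apply: bound => //=; lra.
- by apply: le_trans (CQP y i) _; apply: bound => //=; lra.
Qed.

Lemma tracking_cost_ge0 (R : realType) (m p Tini N : nat) (Q : 'M[R]_p)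
    (Rw : 'M[R]_m) (lamy : R) (x : signals R m p Tini N) :
  posdef Q -> posdef Rw -> 0 < lamy -> 0 <= tracking_cost Q Rw lamy x.
Proof.
case: x => [[s u] y] Q0 R0 lamy0 /=.
rewrite !addr_ge0 ?weighted_sq_ge0 // mulr_ge0 ?(ltW lamy0) //.
by apply: sumr_ge0 => i _; exact: sqr_ge0.
Qed.

Lemma tracking_cost_eq0 (R : realType) (m p Tini N : nat) (Q : 'M[R]_p)
    (Rw : 'M[R]_m) (lamy : R) (x : signals R m p Tini N) :
  posdef Q -> posdef Rw -> 0 < lamy -> tracking_cost Q Rw lamy x = 0 -> x = 0.
Proof.
case: x => [[s u] y] Q0 R0 lamy0 f0.
have [C _ /(_ s u y) [/= + + +]] :=
  @tracking_cost_coord_le _ _ _ Tini N Q Rw lamy Q0 R0 lamy0.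
move: f0 => /= -> ; rewrite mulr0 => s0 u0 y0.
have vec0 k (v : 'cV[R]_k) : (forall i, v i 0 ^+ 2 <= 0) -> v = 0.
  move=> v0; apply/matrixP => i j; rewrite ord1 mxE; apply/eqP.
  by rewrite -sqrf_eq0 eq_le v0 sqr_ge0.
by rewrite (vec0 _ s) // (vec0 _ u) // (vec0 _ y).
Qed.

Lemma tracking_cost_convex (R : realType) (m p Tini N : nat) (Q : 'M[R]_p)
    (Rw : 'M[R]_m) (lamy : R) :
  posdef Q -> posdef Rw -> 0 < lamy ->
  convex_function (E := signals R m p Tini N) setT (tracking_cost Q Rw lamy).
Proof.
move=> Q0 R0 lamy0; apply/convex_functionP => t x y /andP[t0 t1].
rewrite tracking_cost_conv gerBl.
by rewrite !mulr_ge0 ?subr_ge0 // tracking_cost_ge0.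
Qed.

Lemma tracking_cost_midpoint_lt (R : realType) (m p Tini N : nat)
    (Q : 'M[R]_p) (Rw : 'M[R]_m) (lamy : R) (x y : signals R m p Tini N) :
  let f := tracking_cost (Tini := Tini) (N := N) Q Rw lamy in
  posdef Q -> posdef Rw -> 0 < lamy -> f x != f y ->
  f (2^-1 *: x + (1 - 2^-1) *: y) < 2^-1 * f x + (1 - 2^-1) * f y.
Proof.
move=> f Q0 R0 lamy0 fxy.
have fB : 0 < f (x - y).
  rewrite lt_neqAle tracking_cost_ge0 // andbT eq_sym.
  by apply: contra_neq fxy => /(tracking_cost_eq0 Q0 R0 lamy0) /subr0_eq ->.
rewrite /f tracking_cost_conv ltrBlDr ltrDl mulr_gt0 //; lra.
Qed.

(** * The l1 norm and bounded preimages *)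

Lemma norm1_convex (R : realType) (k : nat) :
  convex_function (E := 'cV[R]_k) setT (@norm1 R k).
Proof.
apply/convex_functionP => t x y /andP[t0 t1].
rewrite /norm1 !mulr_sumr -big_split; apply: ler_sum => i _ /=.
rewrite !mxE; apply: le_trans (ler_normD _ _) _.
by rewrite !normrM (ger0_norm t0) (ger0_norm (_ : 0 <= 1 - t)) ?subr_ge0.
Qed.

Lemma norm1D (R : realType) (k : nat) (x y : 'cV[R]_k) :
  norm1 (x + y) <= norm1 x + norm1 y.
Proof.
by rewrite -big_split; apply: ler_sum => i _; rewrite mxE ler_normD.
Qed.

Lemma norm1_col_mx (R : realType) (k l : nat) (x : 'cV[R]_k) (y : 'cV[R]_l) :
  norm1 (col_mx x y) = norm1 x + norm1 y.
Proof.
rewrite /norm1 big_split_ord /=.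
by congr (_ + _); apply: eq_bigr => i _; rewrite ?col_mxEu ?col_mxEd.
Qed.

Lemma norm1_mulmx_le (R : realType) (k l : nat) (A : 'M[R]_(k, l))
    (x : 'cV[R]_l) :
  norm1 (A *m x) <= (\sum_i \sum_j `|A i j|) * norm1 x.
Proof.
rewrite mulr_suml; apply: ler_sum => i _.
rewrite mxE mulr_suml; apply: le_trans (ler_norm_sum _ _ _) _.
apply: ler_sum => j _; rewrite normrM ler_wpM2l //.
by rewrite /norm1 (bigD1 j) //= lerDl; exact: sumr_ge0.
Qed.

Lemma norm1_le_coord (R : realType) (k : nat) (x : 'cV[R]_k) (c : R) :
  (forall i, x i 0 ^+ 2 <= c) -> norm1 x <= (1 + c) *+ k.
Proof.
(* Summing |a| <= 1 + a ^ 2 avoids square roots. *)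
move=> xc; rewrite -[k in leRHS]card_ord -sumr_const; apply: ler_sum => i _.
have : `|x i 0| ^+ 2 <= c by rewrite real_normK ?num_real.
by have := sqr_ge0 (`|x i 0| - 1); have := sqr_ge0 `|x i 0|; lra.
Qed.

(** One fixed matrix, a generalised inverse of [A], picks a solution of every
    solvable system, so that a bound on the right-hand side bounds some
    solution. *)
Lemma mulmx_solution_bounded (R : realType) (q c : nat) (A : 'M[R]_(q, c)) :
  exists2 C, 0 <= C &
    forall g : 'cV[R]_c, exists2 g', A *m g' = A *m g &
      norm1 g' <= C * norm1 (A *m g).
Proof.
pose D := (pinvmx A^T)^T; exists (\sum_i \sum_j `|D i j|).
  by apply: sumr_ge0 => i _; exact: sumr_ge0.
move=> g; exists (D *m (A *m g)); last exact: norm1_mulmx_le.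
apply: trmx_inj; rewrite !trmx_mul !trmxK.
by rewrite mulmxKpV // submxMl.
Qed.

(** The source of the threshold on the l1 bound: the cost is coercive, so its
    sublevel set at [K] is bounded, and with it a suitable choice of [g]. *)
Lemma sublevel_solution_bounded (R : realType) (c m p Tini N : nat)
    (H : 'M[R]_(Tini * m + (Tini * p + (N * m + N * p)), c))
    (uini : 'cV[R]_(Tini * m)) (yini : 'cV[R]_(Tini * p))
    (Q : 'M[R]_p) (Rw : 'M[R]_m) (lamy K : R) :
  posdef Q -> posdef Rw -> 0 < lamy ->
  exists alpha, forall g x, data_equation H uini yini (g, x) ->
    tracking_cost Q Rw lamy x <= K ->
    exists2 g', data_equation H uini yini (g', x) & norm1 g' <= alpha.
Proof.
move=> Q0 R0 lamy0.
have [C C0 CP] := mulmx_solution_bounded H.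
have [E E0 EP] := @tracking_cost_coord_le _ _ _ Tini N Q Rw lamy Q0 R0 lamy0.
exists (C * (norm1 uini + (norm1 yini + (1 + E * K) *+ (Tini * p)
  + ((1 + E * K) *+ (N * m) + (1 + E * K) *+ (N * p))))).
move=> g [[s u] y] /= Hg fK; have [g' Hg' g'le] := CP g.
exists g'; first by rewrite Hg' Hg.
apply: le_trans g'le _; rewrite ler_wpM2l // Hg !norm1_col_mx.
have [sE uE yE] := EP s u y; have EK := ler_wpM2l E0 fK.
rewrite lerD2l lerD ?lerD //.
- apply: le_trans (norm1D _ _) _.
  by rewrite lerD2l norm1_le_coord // => i; exact: le_trans EK.
- by rewrite norm1_le_coord // => i; exact: le_trans EK.
- by rewrite norm1_le_coord // => i; exact: le_trans EK.
Qed.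

(** * Truncated singular value decompositions *)

(** [M] is the orthogonal projection onto the span of the retained right
    singular vectors; only the first [c] of these are orthonormal, whence the
    condition [i < c], and the terms beyond have singular value zero. *)
Lemma truncated_svd_factor (R : realType) (q c : nat) (A : 'M[R]_(q, c))
    (r : nat) (B : 'M[R]_(q, c)) :
  is_truncated_svd A r B -> exists M : 'M[R]_c, B = A *m M.
Proof.
move=> [s [u [v [[_ vv s0 _ ->] ->]]]].
exists (\sum_(i < q | (i < r)%N && (i < c)%N) v i *m (v i)^T).
rewrite mulmx_suml [LHS]big_mkcond; apply: eq_bigr => j _ /=.
have [cj|jc] := leqP c j.
  by rewrite (proj2 (s0 j) cj) !scale0r mul0mx if_same.
rewrite -scalemxAl -mulmxA mulmx_sumr.
have -> : \sum_(i < q | (i < r)%N && (i < c)%N) (v j)^T *m (v i *m (v i)^T)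
    = if (j < r)%N then (v j)^T else 0.
  case: ifP => jr; last first.
    apply: big1 => i /andP[ir ic]; have ji : (j == i) = false.
      by apply/eqP => ji; rewrite ji ir in jr.
    by rewrite mulmxA vv // ji mul_scalar_mx scale0r.
  rewrite (bigD1 j) ?jr ?jc //= mulmxA vv // eqxx mul1mx big1 ?addr0 //.
  move=> i /andP[/andP[_ ic] ij]; rewrite mulmxA vv // eq_sym (negbTE ij).
  by rewrite mul_scalar_mx scale0r.
by case: ifP => _ //; rewrite mulmx0 scaler0.
Qed.

(** * The relaxation *)

Lemma constraint_set_convex (R : realType) (m p Tini N : nat)
    (Gam : set 'cV[R]_(Tini * p)) (U : set 'cV[R]_m) (Y : set 'cV[R]_p) :
  convex_set (M := 'cV[R]_(Tini * p)) Gam ->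
  convex_set (M := 'cV[R]_m) U -> convex_set (M := 'cV[R]_p) Y ->
  convex_set (M := signals R m p Tini N) (constraint_set Gam U Y).
Proof.
move=> /convex_setP cG /convex_setP cU /convex_setP cY; apply/convex_setP.
move=> t [[s1 u1] y1] [[s2 u2] y2] t01 [Gs1 Uu1 Yy1] [Gs2 Uu2 Yy2].
split=> [|k|k]; first exact: cG.
- by rewrite block_lincomb; exact: cU.
- by rewrite block_lincomb; exact: cY.
Qed.

Lemma data_equation_convex (R : realType) (c m p Tini N : nat)
    (H : 'M[R]_(Tini * m + (Tini * p + (N * m + N * p)), c))
    (uini : 'cV[R]_(Tini * m)) (yini : 'cV[R]_(Tini * p)) :
  convex_set (M := decision R c m p Tini N) (data_equation H uini yini).
Proof.
apply/convex_setP => t [g1 [[s1 u1] y1]] [g2 [[s2 u2] y2]] _ /= H1 H2.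
rewrite mulmxDr -!scalemxAr H1 H2 !scale_col_mx !add_col_mx.
congr (col_mx _ (col_mx _ _)); first by rewrite -scalerDl addrC subrK scale1r.
rewrite !scalerDr addrACA -scalerDl [t + _]addrC subrK scale1r //.
Qed.

(** Only the points of the bi-level problem at least as good as a reference
    point [z0] matter, and the signals of each of these are generated by some
    [g] within the l1 bound, with the original data matrix [H]. *)
Lemma l1_constrained_le_bilevel (R : realType) (c m p Tini N : nat)
    (H Hlr : 'M[R]_(Tini * m + (Tini * p + (N * m + N * p)), c))
    (uini : 'cV[R]_(Tini * m)) (yini : 'cV[R]_(Tini * p))
    (Q : 'M[R]_p) (Rw : 'M[R]_m) (lamy : R) (X : set (signals R m p Tini N)) :
  let f := tracking_cost (Tini := Tini) (N := N) Q Rw lamy in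
  posdef Q -> posdef Rw -> 0 < lamy -> (exists M, Hlr = H *m M) ->
  exists alpha_bar, forall alpha, alpha_bar <= alpha ->
    forall w, (forall z : decision R c m p Tini N, X z.2 ->
        data_equation H uini yini z -> norm1 z.1 <= alpha -> f w <= f z.2) ->
    forall z : decision R c m p Tini N, X z.2 ->
      data_equation Hlr uini yini z -> f w <= f z.2.
Proof.
move=> f Q0 R0 lamy0 [M ->].
have [[z0 [Xz0 Ez0]]|empty] := pselect (exists z : decision R c m p Tini N,
    X z.2 /\ data_equation (H *m M) uini yini z); last first.
  by exists 0 => alpha _ w _ z Xz Ez; case: empty; exists z.
have toH (z : decision R c m p Tini N) :
    data_equation (H *m M) uini yini z ->
    data_equation H uini yini (M *m z.1, z.2).
  by case: z => [g [[s u] y]] /=; rewrite mulmxA.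
have [alpha_bar small] :=
  @sublevel_solution_bounded _ _ _ _ _ _ H uini yini Q Rw lamy (f z0.2)
    Q0 R0 lamy0.
exists alpha_bar => alpha le_alpha w wle.
have below z : X z.2 -> data_equation (H *m M) uini yini z ->
    f z.2 <= f z0.2 -> f w <= f z.2.
  move=> Xz /toH Ez fz; have [g' Eg' g'le] := small _ _ Ez fz.
  by apply: (wle (g', z.2)) => //; exact: le_trans le_alpha.
move=> z Xz Ez; have [|/ltW fz0] := leP (f z.2) (f z0.2); first exact: below.
by apply: le_trans fz0; exact: below.
Qed.

Theorem theorem4 (R : realType) (m p n Tini N T : nat)
    (m_gt0 : (0 < m)%N) (p_gt0 : (0 < p)%N) (n_gt0 : (0 < n)%N)
    (Tini_gt0 : (0 < Tini)%N) (N_gt0 : (0 < N)%N) (T_gt0 : (0 < T)%N)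
    (L_lt_T : (Tini + N < T)%N)
    (ud : 'cV[R]_(T * m)) (yd : 'cV[R]_(T * p))
    (uini : 'cV[R]_(Tini * m)) (yini : 'cV[R]_(Tini * p))
    (Q : 'M[R]_p) (Rw : 'M[R]_m) (lamy : R)
    (Gam : set 'cV[R]_(Tini * p)) (U : set 'cV[R]_m) (Y : set 'cV[R]_p)
    (Hstar : 'M[R]_(Tini * m + (Tini * p + (N * m + N * p)),
                    (T - (Tini + N)).+1)) :
  let L := (Tini + N)%N in
  let c := (T - L).+1 in
  let Hd := data_matrix Tini N ud yd in
  let X := constraint_set (m := m) (p := p) (N := N) Gam U Y in
  let f := tracking_cost (Tini := Tini) (N := N) Q Rw lamy in
  let B : problem (decision R c m p Tini N) :=
    Problem [set z | X z.2 /\ data_equation Hstar uini yini z]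
            (fun z => f z.2) in
  let Rl1 (alpha : R) : problem (decision R c m p Tini N) :=
    Problem [set z | [/\ X z.2, data_equation Hd uini yini z
                       & norm1 z.1 <= alpha]]
            (fun z => f z.2) in
  let P (lam : R) : problem (decision R c m p Tini N) :=
    Problem [set z | X z.2 /\ data_equation Hd uini yini z]
            (fun z => f z.2 + lam * norm1 z.1) in
  let slater (alpha : R) :=
    exists z, [/\ feasible (Rl1 alpha) z, relative_interior X z.2
                & norm1 z.1 < alpha] in
  posdef Q -> posdef Rw -> 0 < lamy ->
  convex_set (M := 'cV[R]_(Tini * p)) Gam ->
  convex_set (M := 'cV[R]_m) U -> convex_set (M := 'cV[R]_p) Y ->
  low_rank_solution Hd (m * L + n) Hstar ->
  is_truncated_svd Hd (m * L + n) Hstar ->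
  exists alpha_bar : R, forall alpha_c : R, alpha_bar <= alpha_c ->
    slater alpha_c ->
    (exists2 lam_star : R, 0 <= lam_star &
       optimal (Rl1 alpha_c) `<=` optimal (P lam_star)) /\
    (forall lam_star : R, 0 <= lam_star ->
       optimal (Rl1 alpha_c) `<=` optimal (P lam_star) ->
       forall lam : R, 0 <= lam <= lam_star ->
       [/\ convex_problem (P lam),
           feasible_for B `<=` feasible_for (P lam)
         & (* (Rl1 alpha_c) attains its minimum, e.g. when Gam, U, Y are closed;
              otherwise the condition on lam_star would be vacuous *)
           optimal (Rl1 alpha_c) !=set0 ->
           forall z, optimal (P lam) z ->
             ((f z.2)%:E <= optimal_value B)%E]).
Proof.
move=> L c Hd X f B Rl1 P slater Q0 R0 lamy0 cG cU cY _ svd.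
have [M HM] := truncated_svd_factor svd.
pose F : set (decision R c m p Tini N) :=
  [set z | X z.2 /\ data_equation Hd uini yini z].
have cF : convex_set (M := decision R c m p Tini N) F.
  have /convex_setP cX := constraint_set_convex (N := N) cG cU cY.
  have /convex_setP cE := @data_equation_convex _ _ _ _ _ _ Hd uini yini.
  apply/convex_setP => t x y t01 [Xx Ex] [Xy Ey].
  by split; [exact: cX | exact: cE].
have cf : convex_function (E := decision R c m p Tini N) setT (fun z => f z.2).
  have /convex_functionP cost :=
    tracking_cost_convex (Tini := Tini) (N := N) Q0 R0 lamy0.
  by apply/convex_functionP => t x y; exact: cost.
have ch : convex_function (E := decision R c m p Tini N) setT
    (fun z => norm1 z.1).
  have /convex_functionP n1 := norm1_convex (R := R) (k := c).
  by apply/convex_functionP => t x y; exact: n1.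
have Rl1E alpha : Rl1 alpha =
    Problem [set z | F z /\ norm1 z.1 <= alpha] (fun z => f z.2).
  congr Problem; apply/seteqP; split=> z /=; first by case.
  by case=> -[].
have [alpha_bar aP] := l1_constrained_le_bilevel uini yini X Q0 R0 lamy0
  (ex_intro _ M HM).
exists alpha_bar => alpha le_alpha [b [[Xb Eb _] _ nb]]; split.
  rewrite Rl1E; apply: (optimal_penalized cF cf ch).
  by exists b.
move=> lam_star _ sub lam lam_itv; have /andP[lam0 _] := lam_itv; split.
- by split; [exact: cF | exact: convex_functionD].
- move=> x [g [Xx]]; rewrite HM => Ex; exists (M *m g); split=> //.
  by case: x Xx Ex => -[s u] y /= _; rewrite mulmxA.
- move=> [w wopt] z zopt; apply: le_ereal_inf_tmp => _ [z' [Xz' Ez'] <-].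
  rewrite lee_fin; apply: (@le_trans _ _ (f w.2)).
    apply: (cost_le_smaller_penalty cF ch _ lam_itv (sub _ wopt) zopt).
    by move=> x y; exact: tracking_cost_midpoint_lt.
  apply: (aP alpha) Ez' => // z'' Xz'' Ez'' nz''.
  by case: wopt => _; apply.
Qed.
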